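(* Let $X$ be a Fréchet space over $K$ and let $\{y_n\}_{n=1}^{\infty}$ be a sequence of elements of the dual space $X'$. Suppose that for each $x\in X$ the finite part of the limit $Y(x)=\mathrm{F.p.}\lim_{n\to\infty}\langle y_n,x\rangle$ exists. Then there exist $k\in\mathbb{N}_0$, exponents $\widetilde{\alpha}_1>\cdots>\widetilde{\alpha}_k>0$, and continuous non-zero linear functionals $R_{\widetilde{\alpha}_1},\ldots,R_{\widetilde{\alpha}_k}$ on $X$ such that for all $x\in X$ and all $n\ge 1$ $$\langle y_n,x\rangle=n^{\widetilde{\alpha}_1}R_{\widetilde{\alpha}_1}(x)+\cdots+n^{\widetilde{\alpha}_k}R_{\widetilde{\alpha}_k}(x)+z_n(x),$$ where the finite part $z_n$ is a continuous linear functional on $X$ for every $n$, and where $$Y(x)=\lim_{n\to\infty}z_n(x)\qquad(x\in X)$$ is also a continuous linear functional on $X$.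
   Context: $K$ is $\mathbb{R}$ or $\mathbb{C}$; $X'$ is the space of continuous linear functionals on $X$, and $\langle y,x\rangle$ denotes the evaluation of $y\in X'$ at $x\in X$. $\mathbb{N}_0=\{0,1,2,\ldots\}$. Finite part of the limit: for a given $x\in X$, the finite part $\mathrm{F.p.}\lim_{n\to\infty}\langle y_n,x\rangle$ exists and equals $Y(x)\in K$ if there are $k_x\in\mathbb{N}_0$, real exponents $\alpha_1>\cdots>\alpha_{k_x}>0$ and scalars $R_{\alpha_1}(x),\ldots,R_{\alpha_{k_x}}(x)\in K\setminus\{0\}$ (all allowed to depend on $x$), and scalars $z_n(x)\in K$, such that for all $n\ge1$ $$\langle y_n,x\rangle=n^{\alpha_1}R_{\alpha_1}(x)+\cdots+n^{\alpha_{k_x}}R_{\alpha_{k_x}}(x)+z_n(x)$$ and $\lim_{n\to\infty}z_n(x)=Y(x)$. The sum of the powers is the infinite part (an empty sum, i.e. $0$, if $k_x=0$) and $z_n(x)$ is the finite part; such a decomposition, when it exists, is unique. *)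

(* Defs.v *)
From mathcomp Require Import all_boot all_order all_algebra.
From mathcomp Require Import complex.
From mathcomp Require Import all_classical all_reals all_analysis.

Set Implicit Arguments.
Unset Strict Implicit.
Unset Printing Implicit Defensive.

Import Order.TTheory GRing.Theory Num.Theory.
Import numFieldNormedType.Exports.

Local Open Scope classical_set_scope.
Local Open Scope ring_scope.

Variant scalars := RealScalars | ComplexScalars.

Definition scalar_field (R : realType) (s : scalars) : numFieldType :=
  match s with
  | RealScalars => R
  | ComplexScalars => R[i]
  end.

Definition of_real (R : realType) (s : scalars) : R -> scalar_field R s :=
  match s with
  | RealScalars => fun r => r
  | ComplexScalars => fun r => Complex r 0
  end.

(* Local convexity is part of [tvsType]. The uniform structure carried by a
   [tvsType] is compatible with the topology but is not required to be
   translation invariant, so completeness is not expressed through it: it is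
   asked of a translation-invariant metric inducing the topology. *)
Definition frechet (R : realType) (s : scalars)
    (X : tvsType (scalar_field R s)) : Prop :=
  exists d : X -> X -> R,
    [/\ [/\ forall x y, 0 <= d x y,
            forall x y, d x y = 0 <-> x = y,
            forall x y, d x y = d y x &
            forall x y z, d x z <= d x y + d y z],
        forall x y z, d (x + z) (y + z) = d x y,
        forall (x : X) (U : set X), nbhs x U <->
          exists2 e : R, 0 < e & [set y | d x y < e] `<=` U &
        forall u : nat -> X,
          (forall e : R, 0 < e -> exists N : nat,
            forall m n : nat, (N <= m)%N -> (N <= n)%N -> d (u m) (u n) < e) ->
          exists l : X, u @ \oo --> l].

(* [K^o] is [K] seen as a vector space over itself. *)
Record dual (K : numFieldType) (X : tvsType K) := Dual {
  dual_val :> {linear X -> K^o};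
  dual_continuous : continuous (dual_val : X -> K^o) }.

Definition power_sum (R : realType) (s : scalars) (k : nat)
    (alpha : 'I_k -> R) (c : 'I_k -> scalar_field R s) (n : nat) :
    scalar_field R s :=
  \sum_(i < k) of_real s (n%:R `^ alpha i) * c i.

Definition positive_decreasing (R : realType) (k : nat) (alpha : 'I_k -> R) :
    Prop :=
  (forall i, 0 < alpha i) /\
  (forall i j : 'I_k, (i < j)%N -> alpha j < alpha i).

(* Sequences indexed by n >= 1 are functions on [nat] whose value at 0 is
   never constrained. *)
Definition finite_part_lim (R : realType) (s : scalars)
    (a : nat -> scalar_field R s) (Y : scalar_field R s) : Prop :=
  exists (k : nat) (alpha : 'I_k -> R) (c : 'I_k -> scalar_field R s)
         (z : nat -> scalar_field R s),
    [/\ positive_decreasing alpha,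
        forall i, c i != 0,
        forall n, (1 <= n)%N -> a n = power_sum alpha c n + z n &
        z @ \oo --> Y].

(* Main.v *)
From HB Require Import structures.
Require Import Defs.
From mathcomp Require Import all_boot all_order all_algebra.
From mathcomp Require Import complex.
From mathcomp Require Import all_classical all_reals all_analysis.

Import Order.TTheory GRing.Theory Num.Theory.
Import numFieldNormedType.Exports.

Local Open Scope classical_set_scope.
Local Open Scope ring_scope.

(** Only finitely many exponents can occur over the whole space, and each of
    their coefficients is a limit of continuous functionals; both facts come
    from Baire's theorem.

    Write [c x b] for the coefficient of [n^b] in the expansion of
    [<y_n, x>], and call [b] an exponent if [c x b <> 0] for some [x].  If all
    coefficients above [al] vanish, then [n^(-al) <y_n, x> --> c x al], so that
    [c ^~ al] is a pointwise limit of continuous linear functionals, and hence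
    one itself ([banach_steinhaus_limit]).  This settles the largest exponent,
    once there is one ([max_exponent]).  If there were none, every [x] would
    satisfy [<y_n, x> = O(n^q)] for some rational [q] below some exponent;
    rationals being countable, Baire's theorem makes one such [q] work for all
    [x], which contradicts the exponents above [q].

    To avoid peeling off exponents one at a time, let [B] be the set of all
    exponents with a continuous linear coefficient.  If [B] contained a
    sequence of distinct exponents, then each [x] would be annihilated by all
    coefficients of that sequence from some index on; by Baire's theorem the
    index would be uniform and these coefficients would vanish identically
    ([finite_continuous_exponents]).  So [B] is finite.  Removing the powers
    with exponents in [B] leaves a sequence of the same kind; its largest
    exponent, if it had any, would have a continuous coefficient and would
    therefore lie in [B].  Hence nothing but a convergent sequence of
    functionals remains, and its limit is continuous.

    All uses of Baire's theorem pass through [uniform_boundedness], stated for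
    a countable family of sequences of functionals and of bounds. *)

Set Implicit Arguments.
Unset Strict Implicit.

(** * Scalars *)

(** Real-valued absolute value: the norm of a complex number is itself a
    complex number, so estimates and epsilons are moved to the reals here. *)
Definition modulus (R : realType) (s : scalars) : scalar_field R s -> R :=
  match s with
  | RealScalars => fun x => `|x|
  | ComplexScalars => fun z => complex.Re `|z|
  end.

Section Scalars.
Context (R : realType) (s : scalars).
Local Notation K := (scalar_field R s).
Local Notation phi := (@of_real R s).
Implicit Types (a b : R) (x y : K).

Lemma of_realM a b : phi (a * b) = phi a * phi b.
Proof.
case: s => //=.
by rewrite -[RHS]/(real_complex R a * real_complex R b) -rmorphM.
Qed.

Lemma of_realD a b : phi (a + b) = phi a + phi b.
Proof.
case: s => //=.
by rewrite -[RHS]/(real_complex R a + real_complex R b) -rmorphD.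
Qed.

Lemma of_real0 : phi 0 = 0.
Proof. by case: s. Qed.

Lemma of_real1 : phi 1 = 1.
Proof. by case: s. Qed.

Lemma of_real_le a b : (phi a <= phi b) = (a <= b).
Proof.
case: s => //=.
by rewrite -[LHS]/(real_complex R a <= real_complex R b) lecR.
Qed.

Lemma of_real_lt a b : (phi a < phi b) = (a < b).
Proof.
case: s => //=.
by rewrite -[LHS]/(real_complex R a < real_complex R b) ltcR.
Qed.

Lemma norm_modulus x : `|x| = phi (modulus x).
Proof.
move: x; case: s => [//|x].
have xE : (`|x| : R[i]) =
    Complex (Num.sqrt (complex.Re x ^+ 2 + complex.Im x ^+ 2)) 0 := normc_def x.
exact: etrans xE (congr1 (fun z => Complex (complex.Re z) 0) (esym xE)).
Qed.

Lemma of_real_gt0_ex x : 0 < x -> exists2 e : R, 0 < e & phi e = x.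
Proof.
move: x; case: s => /= [x x0|[a b]]; first by exists x.
by rewrite ltcE /= => /andP[/eqP -> a0]; exists a.
Qed.

Lemma modulus_of_real a : modulus (phi a) = `|a|.
Proof.
case: s => //=.
have aE : (`|Complex a 0| : R[i]) = Complex (Num.sqrt (a ^+ 2 + 0 ^+ 2)) 0 :=
  normc_def (Complex a 0).
apply: etrans (congr1 (@complex.Re R) aE) _.
by rewrite /= expr0n /= addr0 sqrtr_sqr.
Qed.

Let of_real_inj : injective phi.
Proof. by move=> a b ab; apply/eqP; rewrite eq_le -!of_real_le ab lexx. Qed.

Lemma modulusM x y : modulus (x * y) = modulus x * modulus y.
Proof. by apply: of_real_inj; rewrite of_realM -!norm_modulus normrM. Qed.

Lemma modulus_ge0 x : 0 <= modulus x.
Proof. by rewrite -of_real_le -norm_modulus of_real0 normr_ge0. Qed.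

Lemma ler_modulusD x y : modulus (x + y) <= modulus x + modulus y.
Proof. by rewrite -of_real_le of_realD -!norm_modulus ler_normD. Qed.

Lemma modulusN x : modulus (- x) = modulus x.
Proof. by apply: of_real_inj; rewrite -!norm_modulus normrN. Qed.

Lemma ler_modulusB x y : modulus (x - y) <= modulus x + modulus y.
Proof. by rewrite -(modulusN y) ler_modulusD. Qed.

Lemma modulus_eq0 x : (modulus x == 0) = (x == 0).
Proof. by rewrite -(normr_eq0 x) norm_modulus -of_real0 (inj_eq of_real_inj). Qed.

Lemma modulus0 : modulus (0 : K) = 0.
Proof. by apply/eqP; rewrite modulus_eq0. Qed.

Lemma cvg_modulus {T : Type} (F : set_system T) {FF : Filter F} (f : T -> K) l :
  f @ F --> l <-> forall e : R, 0 < e -> \forall t \near F, modulus (l - f t) < e.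
Proof.
rewrite cvgrPdist_lt; split=> [fl e e0|fl e0 /of_real_gt0_ex[e ep <-]].
  have := fl (phi e); rewrite -of_real0 of_real_lt => /(_ e0).
  by apply: filterS => t; rewrite norm_modulus of_real_lt.
by apply: filterS (fl e ep) => t; rewrite norm_modulus of_real_lt.
Qed.

Lemma cvg_of_real (u : nat -> R) l :
  u @ \oo --> l -> phi (u n) @[n --> \oo] --> phi l.
Proof.
move=> /cvgrPdist_lt ul; apply/cvg_modulus => e /ul.
apply: filterS => n; suff -> : phi l - phi (u n) = phi (l - u n).
  by rewrite modulus_of_real.
by apply/eqP; rewrite subr_eq -of_realD subrK.
Qed.

End Scalars.

(** * Continuous linear functionals on a Frechet space *)

Lemma cvgZ_tvs (K : numFieldType) (X : tvsType K) (T : Type) (F : set_system T)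
    {FF : Filter F} (a : T -> K) (v : T -> X) (a0 : K) (v0 : X) :
  a @ F --> a0 -> v @ F --> v0 -> a t *: v t @[t --> F] --> a0 *: v0.
Proof.
move=> aF vF.
apply: (@continuous2_cvg _ K^o X X F FF a v (fun k x => k *: x) a0 v0 _ aF vF).
exact: (@scale_continuous K X (a0, v0)).
Qed.

Lemma cvgD_tvs (K : numFieldType) (X : tvsType K) (T : Type) (F : set_system T)
    {FF : Filter F} (v w : T -> X) (v0 w0 : X) :
  v @ F --> v0 -> w @ F --> w0 -> v t + w t @[t --> F] --> v0 + w0.
Proof.
move=> vF wF.
apply: (@continuous2_cvg _ X X X F FF v w (fun x y => x + y) v0 w0 _ vF wF).
exact: (@add_continuous X (v0, w0)).
Qed.

Section Duals.
Context (R : realType) (s : scalars) (X : tvsType (scalar_field R s)).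
Local Notation K := (scalar_field R s).
Local Notation phi := (@of_real R s).

(** Predicate form of [dual], so that functionals can be built pointwise and
    packed once at the end. *)
Definition is_dual (f : X -> K) : Prop :=
  (forall (k : K) (x x' : X), f (k *: x + x') = k * f x + f x') /\ continuous f.

Lemma is_dualP (f : X -> K) : is_dual f -> exists g : dual X, forall x, g x = f x.
Proof.
move=> [flin fcont].
have fl : linear (f : X -> K^o) by move=> k x x'; rewrite flin.
pose fL : {linear X -> K^o} :=
  HB.pack (f : X -> K^o) (@GRing.isLinear.Build K X K^o *:%R f fl).
by exists (@Dual K X fL fcont).
Qed.

Lemma is_dual_dual (f : dual X) : is_dual f.
Proof.
split; last exact: dual_continuous.
by move=> k x x'; rewrite linearP.
Qed.

Lemma is_dual0 (f : X -> K) : is_dual f -> f 0 = 0.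
Proof.
by move=> [fl _]; have := fl (-1) 0 0; rewrite scaler0 addr0 mulN1r addNr.
Qed.

Lemma is_dualZ (f : X -> K) k x : is_dual f -> f (k *: x) = k * f x.
Proof. by move=> fd; have := fd.1 k x 0; rewrite (is_dual0 fd) !addr0. Qed.

Lemma is_dualB (f : X -> K) x x' : is_dual f -> f (x - x') = f x - f x'.
Proof.
by move=> fd; have := fd.1 (-1) x' x; rewrite scaleN1r mulN1r !(addrC (- _)).
Qed.

Lemma is_dual_lin (k : K) (f g : X -> K) :
  is_dual f -> is_dual g -> is_dual (fun x => k * f x + g x).
Proof.
move=> [fl fc] [gl gc]; split=> [a x x'|x].
  by rewrite fl gl !mulrDr addrACA !(mulrCA k a).
by apply: cvgD; [apply: cvgM; [exact: cvg_cst | exact: fc] | exact: gc].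
Qed.

Lemma is_dual_cst0 : is_dual (fun=> 0).
Proof. by split=> [k x x'|x]; [rewrite mulr0 addr0 | exact: cvg_cst]. Qed.

Lemma is_dual_sum (I : eqType) (r : seq I) (k : I -> K) (f : I -> X -> K) :
  (forall i, i \in r -> is_dual (f i)) ->
  is_dual (fun x => \sum_(i <- r) k i * f i x).
Proof.
elim: r => [|i r IHr] fd.
  by under [X in is_dual X]eq_fun do rewrite big_nil; exact: is_dual_cst0.
under [X in is_dual X]eq_fun do rewrite big_cons.
apply: is_dual_lin; first by apply: fd; rewrite mem_head.
by apply: IHr => j jr; apply: fd; rewrite inE jr orbT.
Qed.

Lemma is_dual_subsum (I : eqType) (r : seq I) (k : I -> K) (f : X -> K)
    (c : X -> I -> K) :
  (forall i, i \in r -> is_dual (c ^~ i)) -> is_dual f ->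
  is_dual (fun x => f x - \sum_(i <- r) k i * c x i).
Proof.
move=> cd fd.
have := is_dual_lin (-1) (is_dual_sum k (f := fun i x => c x i) cd) fd.
by congr is_dual; apply/funext => x; rewrite mulN1r addrC.
Qed.

Lemma is_dual_gt (f : X -> K) (x : X) (b : R) :
  is_dual f -> b < modulus (f x) -> nbhs x [set x' | b < modulus (f x')].
Proof.
move=> [_ fc] bx; have /cvg_modulus fx := fc x.
have : 0 < modulus (f x) - b by rewrite subr_gt0.
move=> /fx; apply: filterS => x' /= xx'.
rewrite -ltrN2 -(ltrD2l (modulus (f x))); apply: le_lt_trans xx'.
by rewrite lerBlDr -[X in modulus X <= _](subrK (f x')) ler_modulusD.
Qed.

(** Neighbourhoods of the origin are absorbing because
    [n^-1 *: x --> 0 *: x]. *)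
Lemma absorbing (U : set X) (x : X) :
  nbhs 0 U -> exists2 r : R, 0 < r & U (phi r *: x).
Proof.
move=> U0; have h0 : phi (n.+1%:R^-1) @[n --> \oo] --> (0 : K).
  by rewrite -(of_real0 R s); apply: cvg_of_real; exact: cvg_harmonic.
have hx : phi (n.+1%:R^-1) *: x @[n --> \oo] --> (0 : K) *: x.
  by apply: cvgZ_tvs => //; exact: cvg_cst.
move: hx; rewrite scale0r => /(_ _ U0)[N _ /(_ N (leqnn N)) /= UN].
by exists N.+1%:R^-1; rewrite // invr_gt0 ltr0n.
Qed.

(** Homogeneity turns a bound [C] on a neighbourhood [U] of the origin into
    the bound [t * C] on [t U]. *)
Lemma bounded_near0_continuous (f : X -> K) (C : R) :
  (forall (k : K) (x x' : X), f (k *: x + x') = k * f x + f x') ->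
  nbhs 0 [set u | modulus (f u) <= C] -> is_dual f.
Proof.
move=> fl fC; split=> // x; apply/cvg_modulus => e e0.
have C1 : 0 < `|C| + 1 by rewrite ltr_wpDl.
(* [`|C| + 1] rather than [C], which may be zero or negative. *)
pose t := e / (`|C| + 1).
have t0 : 0 < t by rewrite divr_gt0.
have : phi t^-1 *: (x' - x) @[x' --> x] --> (0 : X).
  rewrite -[X in _ --> X](scaler0 _ (phi t^-1)).
  apply: cvgZ_tvs; first exact: (@cvg_cst K).
  rewrite -[X in _ --> X](subrr x).
  by apply: cvgD_tvs; [exact: cvg_id|exact: (@cvg_cst X)].
move=> /(_ _ fC) fU.
have {fU} : nbhs x [set x' | modulus (f (phi t^-1 *: (x' - x))) <= C] by [].
apply: filterS => x' /= fx'.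
have -> : f x - f x' = phi (- t) * f (phi t^-1 *: (x' - x)).
  have f0 : f 0 = 0 by have := fl (-1) 0 0; rewrite scaler0 addr0 mulN1r addNr.
  have fZ k u : f (k *: u) = k * f u by have := fl k u 0; rewrite f0 !addr0.
  rewrite fZ mulrA -of_realM mulNr divff ?gt_eqF// (addrC x') -(scaleN1r x) fl.
  have -> : phi (-1) = -1.
    apply/eqP; rewrite -subr_eq0 opprK -(of_real1 R s) -of_realD.
    by rewrite addNr of_real0.
  by rewrite !mulN1r opprD opprK.
rewrite modulusM modulus_of_real normrN gtr0_norm //.
apply: (@le_lt_trans _ _ (t * `|C|)).
  by rewrite ler_pM2l // (le_trans fx') // ler_norm.
by rewrite mulrAC ltr_pdivrMr // ltr_pM2l // ltrDl.
Qed.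

Context (hX : frechet X).

(** Baire's theorem for a cover by closed sets.  If no [F j] had an interior
    point, every ball would contain a smaller closed ball disjoint from the
    next [F j]; the centres of a nested sequence of such balls converge to a
    point outside all the [F j]. *)
Lemma frechet_baire (F : nat -> set X) :
  (forall j (x : X), ~ F j x -> nbhs x (~` F j)) -> (forall x, exists j, F j x) ->
  exists j (x : X), nbhs x (F j).
Proof.
move=> Fclosed Fcover; apply: contrapT => Fint.
case: hX => d [[d_ge0 d_eq0 d_sym d_tri] d_inv d_nbhs d_complete].
(* A state is an index, a centre and a radius. *)
pose step (p q : nat * X * R) := 0 < p.2 ->
  [/\ q.1.1 = p.1.1.+1, 0 < q.2, q.2 <= p.1.1.+1%:R^-1 &
   forall z, d q.1.2 z <= q.2 -> d p.1.2 z < p.2 /\ ~ F p.1.1 z].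
have stepP (p : nat * X * R) : {q | step p q}.
  apply: cid; case: p => [[j x] r]; rewrite /step /=.
  (* [step] asks nothing of a state whose radius is not positive. *)
  have [r0|r0] := ltP 0 r; last by exists (0%N, x, 0).
  have [x' [xx' Fx']] : exists x', d x x' < r /\ ~ F j x'.
    apply: contrapT => hn; apply: Fint; exists j, x; apply/d_nbhs; exists r => //.
    by move=> x' /= xx'; apply: contrapT => Fx'; apply: hn; exists x'.
  have /d_nbhs[e e0 eF] := Fclosed _ _ Fx'.
  pose r1 := (r - d x x') / 2.
  have r10 : 0 < r1 by rewrite divr_gt0 // subr_gt0.
  pose r' := Num.min r1 (Num.min (e / 2) j.+1%:R^-1).
  exists (j.+1, x', r') => _; split=> //=.
  - by rewrite !lt_min r10 divr_gt0 // invr_gt0 ltr0n.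
  - by rewrite !ge_min lexx !orbT.
  - move=> z; rewrite !le_min => /and3P[z1 z2 _]; split.
      apply: le_lt_trans (d_tri x x' z) _; rewrite -ltrBrDl.
      apply: le_lt_trans z1 _.
      by rewrite ltr_pdivrMr // ltr_pMr ?subr_gt0 // ltr1n.
    apply: eF => /=; apply: le_lt_trans z2 _.
    by rewrite ltr_pdivrMr // ltr_pMr // ltr1n.
have [p [p0 pS]] := dependent_choice stepP (0%N, 0 : X, 1 : R).
have p_gt0 n : 0 < (p n).2.
  by elim: n => [|n IHn]; [rewrite p0|have [] := pS n IHn].
have p_idx n : (p n).1.1 = n.
  by elim: n => [|n IHn]; [rewrite p0|have [->] := pS n (p_gt0 n); rewrite IHn].
have p_small n : (p n.+1).2 <= n.+1%:R^-1.
  by have [_ _] := pS n (p_gt0 n); rewrite p_idx.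
pose u n := (p n).1.2.
have p_sub n k z : d (u (n + k)%N) z <= (p (n + k)%N).2 -> d (u n) z <= (p n).2.
  elim: k => [|k IHk]; first by rewrite addn0.
  rewrite addnS => hz; apply: IHk.
  by have [_ _ _ /(_ z hz)[/ltW]] := pS (n + k)%N (p_gt0 _).
have d0 x : d x x = 0 by apply/d_eq0.
have u_near n k : d (u n) (u (n + k)%N) <= (p n).2.
  by apply: (p_sub n k); rewrite d0 ltW.
have [e e0|l ul] := d_complete u.
  have [N Ne] : exists N : nat, N.+1%:R^-1 < e / 2.
    have e20 : 0 < e / 2 by rewrite divr_gt0.
    have [N _ /(_ N (leqnn N)) /= NN] := near_infty_natSinv_lt (PosNum e20).
    by exists N.
  exists N.+1 => m n Nm Nn.
  apply: le_lt_trans (d_tri _ (u N.+1) _) _.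
  rewrite [e]splitr ltrD // (le_lt_trans _ Ne) // (le_trans _ (p_small N)) //.
    by rewrite d_sym -(subnKC Nm) u_near.
  by rewrite -(subnKC Nn) u_near.
have ul_near n : d (u n) l <= (p n).2.
  apply/ler_addgt0Pr => e e0.
  have : nbhs l [set z | d l z < e] by apply/d_nbhs; exists e.
  move=> /ul[N _ /(_ (n + N)%N (leq_addl n N))] /= le.
  apply: le_trans (d_tri _ (u (n + N)%N) _) _; rewrite lerD ?u_near //.
  by rewrite d_sym ltW.
have [j Fj] := Fcover l.
by have [_ _ _ /(_ l (ul_near _))[_]] := pS j (p_gt0 j); rewrite p_idx.
Qed.

(** The sets [G j] of points satisfying the [j]-th bounds are closed and cover
    the space, so one of them is a neighbourhood of some [x]; differences
    [(x + u) - x] then fill a neighbourhood of the origin, at the cost of the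
    factor 2.  The index type is arbitrary countable because it will be a
    rational exponent together with a constant. *)
Lemma uniform_boundedness (J : countType) (g : J -> nat -> X -> K)
    (b : J -> nat -> R) :
  (forall j n, is_dual (g j n)) ->
  (forall x, exists j, forall n, modulus (g j n x) <= b j n) ->
  exists j, nbhs 0 [set u | forall n, modulus (g j n u) <= 2 * b j n].
Proof.
move=> gd gb.
pose G j : set X := [set x | forall n, modulus (g j n x) <= b j n].
(* Numbers that code no index contribute the empty set. *)
pose F i : set X := if unpickle i is Some j then G j else set0.
have [i x Fx|x|i [x xF]] := frechet_baire (F := F).
- move: Fx; rewrite /F; case: (unpickle i) => [j|]; last first.
    by move=> _; rewrite setC0; exact: filterT.
  move=> /existsNP[n /negP]; rewrite -ltNge => hn.
  apply: filterS (is_dual_gt (gd j n) hn) => x' /= hx' /(_ n).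
  by rewrite leNgt hx'.
- by have [j hj] := gb x; exists (pickle j); rewrite /F pickleK.
have := nbhs_singleton xF.
move: xF; rewrite /F; case: (unpickle i) => [j xF Fx|_ []]; exists j.
have : x + u @[u --> 0] --> x.
  rewrite -[X in _ --> X](addr0 x).
  by apply: cvgD_tvs; [exact: (@cvg_cst X)|exact: cvg_id].
move=> /(_ _ xF) GU; have {GU} : nbhs 0 [set u | G j (x + u)] by [].
apply: filterS => u /= Fxu n.
have -> : u = (x + u) - x by rewrite addrC addKr.
rewrite (is_dualB _ _ (gd j n)) (le_trans (ler_modulusB _ _)) //.
by rewrite mulr_natl mulr2n lerD // ?Fxu ?Fx.
Qed.

End Duals.

Lemma eventually_bounded (R : realType) (u : nat -> R) (C : R) :
  (\forall n \near \oo, u n <= C) -> exists m : nat, forall n, u n <= m%:R.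
Proof.
move=> [N _ uC].
have [D uD] : exists D, forall n, (n < N)%N -> u n <= D.
  elim: N {uC} => [|N [D uD]]; first by exists 0.
  exists (Num.max D (u N)) => n.
  rewrite ltnS leq_eqVlt le_max => /predU1P[->|/uD->//].
  by rewrite lexx orbT.
exists (Num.truncn (Num.max C D)).+1 => n; apply: ltW.
apply: le_lt_trans (truncnS_gt _).
by rewrite le_max; case: (ltnP n N) => [/uD->|/uC ->//]; rewrite orbT.
Qed.

Lemma cvg_bounded (R : realType) (s : scalars) (a : nat -> scalar_field R s)
    (l : scalar_field R s) :
  a @ \oo --> l -> exists m : nat, forall n, modulus (a n) <= m%:R.
Proof.
move=> /cvg_modulus /(_ 1 ltr01) al.
apply: (@eventually_bounded _ _ (modulus l + 1)).
apply: filterS al => n /ltW ln.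
by rewrite -[X in modulus X](subKr l) (le_trans (ler_modulusB _ _)) // lerD2l.
Qed.

(** Convergent sequences are bounded, so the functionals are uniformly bounded
    near the origin, and so is their limit. *)
Lemma banach_steinhaus_limit (R : realType) (s : scalars)
    (X : tvsType (scalar_field R s)) (f : nat -> X -> scalar_field R s)
    (g : X -> scalar_field R s) :
  frechet X -> (forall n, is_dual (f n)) ->
  (forall x, f n x @[n --> \oo] --> g x) -> is_dual g.
Proof.
move=> hX fd fg.
have [x|m mU] := uniform_boundedness hX (g := fun (_ : nat) n => f n)
  (b := fun m _ => m%:R) (fun _ => fd).
  by have [m fm] := cvg_bounded (fg x); exists m.
apply: (@bounded_near0_continuous _ _ _ _ (2 * m%:R)).
  move=> k x x'.
  have fl : f n (k *: x + x') @[n --> \oo] --> k * g x + g x'.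
    have -> : (fun n => f n (k *: x + x')) = (fun n => k * f n x + f n x').
      by apply/funext => n; rewrite (fd n).1.
    by apply: cvgD => //; apply: cvgM => //; exact: cvg_cst.
  by apply: cvg_unique (fg _) fl; exact: norm_hausdorff.
apply: filterS mU => u /= fu; rewrite leNgt; apply/negP => gu.
have /cvg_modulus /(_ (modulus (g u) - 2 * m%:R)) := fg u.
rewrite subr_gt0 => /(_ gu) [N _ /(_ N (leqnn N))] /=.
apply/negP; rewrite -leNgt lerBlDr.
rewrite -[X in modulus X <= _](subrK (f N u)).
by rewrite (le_trans (ler_modulusD _ _)) // lerD2l.
Qed.

(** * Expansions in powers *)

Lemma powR_neg_cvg0 (R : realType) (g : R) :
  g < 0 -> (n%:R : R) `^ g @[n --> \oo] --> (0 : R).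
Proof.
move=> g0; apply/cvgrPdist_lt => e e0.
near=> n.
have n0 : (0 : R) < n%:R by rewrite ltr0n; near: n; exact: nbhs_infty_gt.
have e0' : 0 < e^-1 by rewrite invr_gt0.
rewrite sub0r normrN ger0_norm ?powR_ge0 // -(opprK g) powRN.
rewrite -[ltRHS]invrK ltf_pV2 ?posrE ?powR_gt0 //.
have -> : e^-1 = (e^-1 `^ (- g)^-1) `^ (- g).
  by rewrite -powRrM mulVf ?powRr1 1?ltW // oppr_eq0 lt_eqF.
apply: gt0_ltr_powR; rewrite ?oppr_gt0 ?nnegrE ?powR_ge0 ?ler0n //.
by near: n; exact: nbhs_infty_gtr.
Unshelve. all: by end_near. Qed.

Lemma seq_max (R : realType) (S : seq R) (P : R -> Prop) (a : R) :
  a \in S -> P a ->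
  exists m, [/\ m \in S, a <= m, P m & forall b, b \in S -> m < b -> ~ P b].
Proof.
elim: S a => [//|x S IHS] a aS Pa.
have [[b [bS Pb ab]]|nb] := pselect (exists b, [/\ b \in S, P b & a <= b]).
  have [m [mS bm Pm mmax]] := IHS b bS Pb.
  have am := le_trans ab bm.
  have [[xm Px]|nx] := pselect (m < x /\ P x).
    exists x; split; rewrite ?mem_head // ?(le_trans am) ?ltW // => c.
    rewrite inE => /predU1P[->|cS xc]; first by rewrite ltxx.
    by apply: mmax => //; exact: lt_trans xc.
  exists m; split; rewrite ?inE ?mS ?orbT // => c /predU1P[->|cS].
    by move=> mx Px; apply: nx.
  exact: mmax.
exists a; split => // c; rewrite inE => /predU1P[->|cS] ac Pc; last first.
  by apply: nb; exists c; rewrite ltW.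
move: aS; rewrite inE => /predU1P[ax|aS]; first by rewrite ax ltxx in ac.
by apply: nb; exists a.
Qed.

Lemma big_support (R : choiceType) (V : nmodType) (S T : seq R) (F : R -> V) :
  uniq S -> uniq T -> {subset S <= T} -> (forall b, b \notin S -> F b = 0) ->
  \sum_(b <- T) F b = \sum_(b <- S) F b.
Proof.
move=> uS uT ST F0; rewrite (bigID (mem S)) /= [X in _ + X]big1 // addr0.
rewrite -big_filter; apply: perm_big; apply: uniq_perm => //.
  exact: filter_uniq.
by move=> b; rewrite mem_filter andb_idr // => /ST.
Qed.

Section Expansions.
Context (R : realType) (s : scalars).
Local Notation K := (scalar_field R s).
Local Notation phi := (@of_real R s).
Implicit Types (a : nat -> K) (c : R -> K) (l : K).

(** The coefficients are a function of the exponent, zero outside a finite set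
    [S] of positive reals.  Exponents of [S] may have a zero coefficient: this
    makes expansions over different sets easy to add, and lets [c x] be
    compared for different vectors [x]. *)
Definition expansion a c l : Prop :=
  exists S : seq R,
    [/\ uniq S, forall b, b \in S -> 0 < b, forall b, b \notin S -> c b = 0 &
        a n - \sum_(b <- S) phi (n%:R `^ b) * c b @[n --> \oo] --> l].

Lemma cvg_eq_pos (f g : nat -> K) l :
  (forall n, (0 < n)%N -> f n = g n) -> f @ \oo --> l -> g @ \oo --> l.
Proof.
move=> fg /cvg_modulus fl; apply/cvg_modulus => e e0; near=> n.
rewrite -fg; first by near: n; exact: fl.
by near: n; exact: nbhs_infty_gt.
Unshelve. all: by end_near. Qed.

Lemma scalar_cvg_unique (f : nat -> K) (l l' : K) :
  f @ \oo --> l -> f @ \oo --> l' -> l = l'.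
Proof. by apply: cvg_unique; exact: norm_hausdorff. Qed.

Lemma finite_part_expansion a l :
  finite_part_lim a l -> exists c, expansion a c l.
Proof.
move=> [k [alpha [c [z [[alpha0 alpha_dec] _ aE zl]]]]].
have alpha_inj : injective alpha.
  move=> i j ij; apply/eqP; case: (ltngtP i j) => //= h; last exact/eqP/val_inj.
    by have := alpha_dec _ _ h; rewrite ij ltxx.
  by have := alpha_dec _ _ h; rewrite ij ltxx.
exists (fun b => \sum_(i < k | alpha i == b) c i), (map alpha (enum 'I_k)); split.
- by rewrite map_inj_uniq // enum_uniq.
- by move=> b /mapP[i _ ->].
- move=> b bS; apply: big1 => i /eqP ib; case/negP: bS.
  by rewrite -ib map_f // mem_enum.
- apply: cvg_eq_pos zl => n n0; rewrite big_map big_enum /=.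
  rewrite aE // /power_sum; apply/esym/eqP; rewrite subr_eq addrC; apply/eqP.
  congr (_ + _); apply: eq_bigr => i _.
  by rewrite (big_pred1 i) // => j; rewrite /= (inj_eq alpha_inj).
Qed.

(** After division by [n^al] the remainder and the powers below [al] tend to
    zero.  The coefficient [c al] is allowed to vanish. *)
Lemma expansion_leading a c l al : expansion a c l -> 0 < al ->
  (forall b, al < b -> c b = 0) ->
  phi (n%:R `^ (- al)) * a n @[n --> \oo] --> c al.
Proof.
move=> [S [uS S0 cS al_]] al0 cmax.
pose F b n := phi (n%:R `^ (- al)) * (phi (n%:R `^ b) * c b).
have FE b : F b n @[n --> \oo] --> (if b == al then c al else 0).
  have E n : (0 < n)%N -> phi (n%:R `^ (b - al)) * c b = F b n.
    move=> n0; rewrite /F mulrA -of_realM addrC powRD //.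
    by rewrite pnatr_eq0 -lt0n n0 implybT.
  apply: (cvg_eq_pos E); have [bal|bal|->] := ltgtP b al.
  - rewrite -[X in _ --> X](mul0r (c b)); apply: cvgM; last exact: cvg_cst.
    rewrite -(of_real0 R s); apply: cvg_of_real; apply: powR_neg_cvg0.
    by rewrite subr_lt0.
  - by rewrite cmax //; under eq_fun do rewrite mulr0; exact: cvg_cst.
  - under eq_fun do rewrite subrr powRr0 of_real1 mul1r; exact: cvg_cst.
have sumE : \sum_(b <- S) (if b == al then c al else 0) = c al.
  have [alS|alS] := boolP (al \in S); last first.
    by rewrite cS // big1 // => b _; case: ifP.
  by rewrite (bigD1_seq al) //= eqxx big1 ?addr0 // => b /negPf ->.
have -> : c al = 0 * l + c al by rewrite mul0r add0r.
rewrite -sumE.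
have -> : (fun n => phi (n%:R `^ (- al)) * a n) =
    (fun n => phi (n%:R `^ (- al)) * (a n - \sum_(b <- S) phi (n%:R `^ b) * c b)
      + \sum_(b <- S) F b n).
  by apply/funext => n; rewrite /F -big_distrr /= -mulrDr subrK.
apply: cvgD.
  apply: cvgM => //; rewrite -(of_real0 R s); apply: cvg_of_real.
  by apply: powR_neg_cvg0; rewrite oppr_lt0.
by apply: cvg_big => //; exact: add_continuous.
Qed.

Lemma expansion_max a c l b : expansion a c l -> c b != 0 ->
  exists m, [/\ 0 < m, b <= m, c m != 0 & forall b', m < b' -> c b' = 0].
Proof.
move=> [S [uS S0 cS _]] cb.
have inS b' : c b' != 0 -> b' \in S by apply: contraNT => /cS ->.
have [m [mS bm cm mmax]] := @seq_max _ S (fun b => c b != 0) b (inS _ cb) cb.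
exists m; split=> //; first exact: S0.
move=> b' mb'; apply/eqP; apply: contrapT => /negP cb'.
by apply: (mmax b') => //; exact: inS.
Qed.

Lemma expansion_lin k a c l a' c' l' : expansion a c l -> expansion a' c' l' ->
  expansion (fun n => k * a n + a' n) (fun b => k * c b + c' b) (k * l + l').
Proof.
move=> [S [uS S0 cS al]] [S' [uS' S'0 cS' al']].
pose T := undup (S ++ S').
exists T; split; first exact: undup_uniq.
- by move=> b; rewrite mem_undup mem_cat => /orP[/S0|/S'0].
- move=> b; rewrite mem_undup mem_cat negb_or => /andP[/cS-> /cS'->].
  by rewrite mulr0 addr0.
have E n : \sum_(b <- T) phi (n%:R `^ b) * c b =
    \sum_(b <- S) phi (n%:R `^ b) * c b.
  apply: big_support => //; first exact: undup_uniq.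
    by move=> b bS; rewrite mem_undup mem_cat bS.
  by move=> b /cS ->; rewrite mulr0.
have E' n : \sum_(b <- T) phi (n%:R `^ b) * c' b =
    \sum_(b <- S') phi (n%:R `^ b) * c' b.
  apply: big_support => //; first exact: undup_uniq.
    by move=> b bS; rewrite mem_undup mem_cat bS orbT.
  by move=> b /cS' ->; rewrite mulr0.
have -> : (fun n => k * a n + a' n -
      \sum_(b <- T) phi (n%:R `^ b) * (k * c b + c' b)) =
    (fun n => k * (a n - \sum_(b <- S) phi (n%:R `^ b) * c b) +
      (a' n - \sum_(b <- S') phi (n%:R `^ b) * c' b)).
  apply/funext => n; rewrite -E -E' mulrBr addrACA -opprD; congr (_ - _).
  rewrite big_distrr -big_split /=.
  by apply: eq_bigr => b _; rewrite mulrDr mulrCA.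
by apply: cvgD => //; apply: cvgM => //; exact: cvg_cst.
Qed.

(** Apply [expansion_leading] to the largest exponent [m] above [q] with a
    nonzero coefficient: [n^(-m) a n] is also [O(n^(q - m))]. *)
Lemma expansion_bounded a c l (q C : R) b : expansion a c l ->
  (forall n, (0 < n)%N -> modulus (a n) <= C * n%:R `^ q) ->
  0 < q -> q < b -> c b = 0.
Proof.
move=> e aC q0 qb; apply/eqP; apply: contrapT => /negP cb.
have [m [m0 bm cm mmax]] := expansion_max e cb.
have qm : q < m := lt_le_trans qb bm.
case/negP: cm; apply/eqP.
apply: scalar_cvg_unique (expansion_leading e m0 mmax) _.
apply/cvg_modulus => eps eps0.
have : C * n%:R `^ (q - m) @[n --> \oo] --> C * 0.
  by apply: cvgM; [exact: cvg_cst|apply: powR_neg_cvg0; rewrite subr_lt0].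
rewrite mulr0 => /cvgrPdist_lt/(_ _ eps0) h; near=> n.
have n0 : (0 < n)%N by near: n; exact: nbhs_infty_gt.
have : `|0 - C * n%:R `^ (q - m)| < eps by near: n; exact: h.
rewrite !sub0r normrN modulusN; apply: le_lt_trans.
rewrite modulusM modulus_of_real ger0_norm ?powR_ge0 //.
apply: le_trans (ler_norm _).
rewrite (addrC q) powRD; last by rewrite pnatr_eq0 -lt0n n0 implybT.
by rewrite mulrCA ler_wpM2l ?powR_ge0 ?aC.
Unshelve. all: by end_near. Qed.

Lemma expansion_power_sum (T : seq R) c :
  uniq T -> (forall b, b \in T -> 0 < b) ->
  expansion (fun n => \sum_(b <- T) phi (n%:R `^ b) * c b)
    (fun b => if b \in T then c b else 0) 0.
Proof.
move=> uT T0; exists T; split=> // [b /negPf->//|].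
have -> : (fun n => \sum_(b <- T) phi (n%:R `^ b) * c b -
   \sum_(b <- T) phi (n%:R `^ b) * (if b \in T then c b else 0)) = (fun=> 0).
  apply/funext => n; apply/eqP; rewrite subr_eq0; apply/eqP.
  by apply: eq_big_seq => b ->.
exact: cvg_cst.
Qed.

End Expansions.

(** * Coefficients as functionals *)

Section Coefficients.
Context (R : realType) (s : scalars) (X : tvsType (scalar_field R s)).
Context (hX : frechet X).
Local Notation K := (scalar_field R s).
Local Notation phi := (@of_real R s).

Lemma near0_absorb (f : nat -> X -> K) (b : nat -> R) (x : X) :
  (forall n, is_dual (f n)) ->
  nbhs 0 [set u | forall n, modulus (f n u) <= b n] ->
  exists C : R, forall n, modulus (f n x) <= C * b n.
Proof.
move=> fd /absorbing => /(_ x)[r r0 /= fb]; exists r^-1 => n.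
rewrite -(ler_pM2l r0) mulrA divff ?gt_eqF // mul1r.
by have := fb n; rewrite (is_dualZ _ _ (fd n)) modulusM modulus_of_real gtr0_norm.
Qed.

Context (y : nat -> X -> K) (c : X -> R -> K) (Y : X -> K).
Context (yd : forall n, is_dual (y n)).
Context (ye : forall x, expansion (y ^~ x) (c x) (Y x)).

(** Suppose every exponent has a larger one.  The expansion of [x] stops at
    some exponent, and a rational [q] fits between it and the next one, so
    [y n x = O(n^q)].  Uniform boundedness over the countably many pairs of [q]
    and a constant gives one [q] valid for every [x], although some exponent
    exceeds [q]. *)
Lemma max_exponent x0 b0 : c x0 b0 != 0 ->
  exists al, [/\ 0 < al, exists x, c x al != 0 &
                 forall x b, al < b -> c x b = 0].
Proof.
move=> cb0; pose A b := exists x, c x b != 0.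
have A0 b : A b -> 0 < b.
  move=> [x]; have [S [_ S0 cS _]] := ye x.
  by have [/S0//|/cS ->] := boolP (b \in S); rewrite eqxx.
apply: contrapT => nomax.
have above b : A b -> exists2 b', b < b' & A b'.
  move=> Ab; apply: contrapT => nb; apply: nomax; exists b.
  split; [exact: A0|by []|].
  move=> x b' bb'; apply/eqP; apply: contrapT => /negP cb'; apply: nb.
  by exists b' => //; exists x.
pose J := (rat * nat)%type.
pose good (q : rat) := `[< 0 < (ratr q : R) /\ exists2 b, ratr q < b & A b >].
(* The bound -1 cannot be met, which restricts the family to the good [q]. *)
pose bd (j : J) (n : nat) : R :=
  if good j.1 then j.2%:R * n.+1%:R `^ (ratr j.1) else -1.
have [x|[q m]] := uniform_boundedness hX (g := fun (_ : J) n => y n.+1) (b := bd)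
  (fun _ n => yd n.+1).
  have [m Am mmax] : exists2 m, A m & forall b, m < b -> c x b = 0.
    have [[b cb]|cn] := pselect (exists b, c x b != 0).
      have [m [_ _ cm mmax]] := expansion_max (ye x) cb.
      by exists m => //; exists x.
    exists b0; first by exists x0.
    by move=> b _; apply/eqP; apply: contrapT => /negP cb; apply: cn; exists b.
  have [b mb Ab] := above m Am.
  have [q] := rat_in_itvoo mb; rewrite in_itv /= => /andP[mq qb].
  have q0 : 0 < (ratr q : R) := lt_trans (A0 _ Am) mq.
  have gq : good q by apply/asboolP; split=> //; exists b.
  have [N hN] := cvg_bounded (expansion_leading (ye x) q0
    (fun b' qb' => mmax b' (lt_trans mq qb'))).
  exists (q, N) => n; rewrite /bd /= gq.
  have n0 : (0 : R) < n.+1%:R by rewrite ltr0n.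
  have := hN n.+1; rewrite modulusM modulus_of_real ger0_norm ?powR_ge0 //.
  by rewrite powRN mulrC ler_pdivrMr ?powR_gt0.
move=> hU; have [gq|gq] := boolP (good q); last first.
  have := nbhs_singleton hU 0%N; rewrite /bd /= (negPf gq) => h.
  by have := le_trans (modulus_ge0 _) h; rewrite mulrN1 oppr_ge0 leNgt ltr0n.
have /asboolP[q0 [b qb [x cx]]] := gq.
have [C hC] := near0_absorb x (fun n => yd n.+1) hU.
case/negP: cx; apply/eqP.
apply: (@expansion_bounded _ _ _ _ _ (ratr q) (C * (2 * m%:R)) b (ye x)) => //.
by case=> [//|n] _; have := hC n; rewrite /bd /= gq !mulrA.
Qed.

Lemma max_exponent_coef_dual al : 0 < al ->
  (forall x b, al < b -> c x b = 0) -> is_dual (c ^~ al).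
Proof.
move=> al0 cmax.
apply: (banach_steinhaus_limit (f := fun n x => phi (n%:R `^ (- al)) * y n x) hX).
  move=> n; have := is_dual_lin (phi (n%:R `^ (- al))) (yd n) (is_dual_cst0 X).
  by under eq_fun do rewrite addr0.
by move=> x; apply: expansion_leading => //; exact: cmax.
Qed.

(** If [h] enumerates distinct elements of the set, the coefficients
    [c x (h i)] of a given [x] vanish for large [i].  Uniform boundedness with
    all bounds zero yields one [j] such that [c u (h j) = 0] for all [u] near
    the origin, hence for all [u]. *)
Lemma finite_continuous_exponents :
  finite_set [set b | (exists x, c x b != 0) /\ is_dual (c ^~ b)].
Proof.
set B := [set b | _]; apply: contrapT => /infiniteP/pcard_leP[h].
have hB i : B (h i) by exact: (@funS _ _ _ _ h).
have h_inj : injective h.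
  by move=> i j; apply: (@inj _ _ setT h); rewrite in_setT.
have h_leaves (S : seq R) : exists j, forall i, h (j + i)%N \notin S.
  elim: S => [|b S [j hj]]; first by exists 0%N.
  have [[k kb]|nk] := pselect (exists k, h k = b); last first.
    exists j => i; rewrite inE negb_or hj andbT.
    by apply/eqP => e; apply: nk; exists (j + i)%N.
  exists (j + k.+1)%N => i; rewrite inE negb_or -addnA hj andbT -kb.
  by rewrite (inj_eq h_inj) gtn_eqF // (leq_trans _ (leq_addl _ _)) // leq_addr.
have [x|j hU] := uniform_boundedness hX
  (g := fun j i x => c x (h (j + i)%N)) (b := fun _ _ => 0) (fun j i => (hB _).2).
  have [S [_ _ cS _]] := ye x; have [j hj] := h_leaves S.
  by exists j => i; rewrite cS // modulus0.
have [[x cx] cd] := hB j; case/negP: cx; apply/eqP.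
have [C /(_ 0%N)] := near0_absorb x (fun i => (hB (j + i)%N).2) hU.
rewrite !mulr0 addn0 => h0; apply/eqP; rewrite -modulus_eq0 eq_le h0.
exact: modulus_ge0.
Qed.

End Coefficients.

(** * The theorem *)

(** [T] lists the exponents with a continuous linear coefficient.  If other
    exponents remained once these powers are subtracted, the largest of them
    would have such a coefficient too and would belong to [T]. *)
Lemma finite_expansion (R : realType) (s : scalars)
    (X : tvsType (scalar_field R s)) (y : nat -> X -> scalar_field R s)
    (c : X -> R -> scalar_field R s) (Y : X -> scalar_field R s) :
  frechet X -> (forall n, is_dual (y n)) ->
  (forall x, expansion (y ^~ x) (c x) (Y x)) ->
  exists T : seq R,
    [/\ uniq T, forall b, b \in T -> 0 < b,
        forall b, b \in T -> exists x, c x b != 0,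
        forall b, b \in T -> is_dual (c ^~ b) &
        forall x, y n x - \sum_(b <- T) of_real s (n%:R `^ b) * c x b
          @[n --> \oo] --> Y x].
Proof.
move=> hX yd ye.
have /finite_seqP[T0 BE] := finite_continuous_exponents hX ye.
pose T := undup T0.
have TP b : b \in T <-> (exists x, c x b != 0) /\ is_dual (c ^~ b).
  rewrite mem_undup; split=> [bT|hb].
    by have : [set` T0] b by []; rewrite -BE.
  by have : [set` T0] b by rewrite -BE.
have T_gt0 b : b \in T -> 0 < b.
  move=> /TP[[x]]; have [S [_ S0 cS _]] := ye x.
  by have [/S0//|/cS ->] := boolP (b \in S); rewrite eqxx.
exists T; split=> //; first exact: undup_uniq.
- by move=> b /TP[].
- by move=> b /TP[].
pose y' n x := y n x - \sum_(b <- T) of_real s (n%:R `^ b) * c x b.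
pose c' x b := if b \in T then 0 else c x b.
have y'd n : is_dual (y' n).
  exact: is_dual_subsum (fun b bT => ((TP b).1 bT).2) (yd n).
have y'e x : expansion (y' ^~ x) (c' x) (Y x).
  have := expansion_lin (-1)
    (expansion_power_sum (c x) (undup_uniq T0) T_gt0) (ye x).
  rewrite mulr0 add0r; congr expansion.
    by apply/funext => n; rewrite mulN1r addrC.
  apply/funext => b; rewrite /c'; case: ifP => _; first by rewrite mulN1r addNr.
  by rewrite mulr0 add0r.
have c'0 x b : c' x b = 0.
  apply/eqP; apply: contrapT => /negP cb.
  have [al [al0 [x' cx'] c'max]] := max_exponent hX y'd y'e cb.
  have c'd := max_exponent_coef_dual hX y'd y'e al0 c'max.
  have alT : al \notin T by apply: contraNN cx' => alT; rewrite /c' alT.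
  have c'E : c' ^~ al = c ^~ al by apply/funext => z; rewrite /c' (negPf alT).
  case/negP: alT; apply/TP; rewrite -c'E; split=> //.
  by exists x'; rewrite -[c x' al]/((c ^~ al) x') -c'E.
move=> x; have [S [_ _ _]] := y'e x.
have -> // : (fun n => y' n x -
    \sum_(b <- S) of_real s (n%:R `^ b) * c' x b) = y' ^~ x.
by apply/funext => n; rewrite big1 ?subr0 // => b _; rewrite c'0 mulr0.
Qed.

Unset Implicit Arguments.

Theorem theorem3p4 (R : realType) (s : scalars)
    (X : tvsType (scalar_field R s)) (hX : frechet X)
    (y : nat -> dual X) (Y : X -> scalar_field R s)
    (hY : forall x : X, finite_part_lim (fun n => y n x) (Y x)) :
  exists (k : nat) (alpha : 'I_k -> R) (Rt : 'I_k -> dual X)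
         (z : nat -> dual X) (Y' : dual X),
    [/\ positive_decreasing alpha,
        forall i : 'I_k, exists x : X, Rt i x != 0,
        forall (x : X) (n : nat), (1 <= n)%N ->
          y n x = power_sum alpha (fun i => Rt i x) n + z n x,
        forall x : X, z n x @[n --> \oo] --> Y x &
        forall x : X, Y' x = Y x].
Proof.
have [c ye] := choice (fun x => finite_part_expansion (hY x)).
have yd n := is_dual_dual (y n).
have [T [uT T_gt0 Tne Td Ycvg]] := finite_expansion hX yd ye.
pose T' := rev (sort <=%O T).
have T'T b : (b \in T') = (b \in T) by rewrite mem_rev mem_sort.
have T'sorted : sorted >%O T' by rewrite rev_sorted sort_lt_sorted.
pose k := size T'; pose alpha (i : 'I_k) := nth 0 T' i.
have alphaT i : alpha i \in T by rewrite -T'T mem_nth.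
have [Rt RtE] := choice (fun i : 'I_k => is_dualP (Td _ (alphaT i))).
pose z0 n x := y n x - \sum_(b <- T) of_real s (n%:R `^ b) * c x b.
have z0d n : is_dual (z0 n) by exact: is_dual_subsum Td (yd n).
have [z zE] := choice (fun n => is_dualP (z0d n)).
have [Y' Y'E] := is_dualP (banach_steinhaus_limit hX z0d Ycvg).
exists k, alpha, Rt, z, Y'; split=> //.
- split=> [i|i j ij]; first exact: T_gt0.
  apply: (sorted_ltn_nth _ 0 T'sorted); rewrite ?inE //.
  by move=> a b d ab bd; apply: lt_trans bd ab.
- by move=> i; have [x cx] := Tne _ (alphaT i); exists x; rewrite RtE.
- move=> x n _; rewrite zE /z0 /power_sum.
  have -> : \sum_(i < k) of_real s (n%:R `^ alpha i) * Rt i x =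
      \sum_(b <- T) of_real s (n%:R `^ b) * c x b.
    rewrite (perm_big T') /=; last by rewrite perm_sym perm_rev perm_sort.
    by rewrite (big_nth 0) big_mkord; apply: eq_bigr => i _; rewrite RtE.
  by rewrite addrC subrK.
- move=> x; have -> : (fun n => z n x) = z0 ^~ x by apply/funext => n; rewrite zE.
  exact: Ycvg.
Qed.
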